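(* The Hanoi towers group $\Gamma=\langle a,b,c\rangle\le\mathrm{Aut}(X^* )$ is a self-similar, regular branch group with branching subgroup its commutator subgroup $\Gamma'$.
   Context: Let $X=\{1,2,3\}$ and let $X^*$ be the infinite rooted ternary tree: its vertices are the finite words over $X$, the root is the empty word $\varnothing$, and each word $w$ is joined to $wx$ for $x\in X$. The level $|u|$ of a vertex $u$ is its length. $\mathrm{Aut}(X^* )$ is the group of root-preserving, edge-preserving bijections of the vertex set; it acts on the right, $u\mapsto u^g$. For $g\in\mathrm{Aut}(X^* )$ and a vertex $u$, the state $g@u\in\mathrm{Aut}(X^* )$ is the automorphism determined by $(uw)^g=u^g\,w^{g@u}$ for all words $w$; for a subset $S\subseteq\mathrm{Aut}(X^* )$, $S@u=\{g@u:g\in S\}$. One writes $g=(g_1,g_2,g_3)\sigma$ when $g_i=g@i$ for $i\in X$ and $\sigma\in S_3$ is the permutation by which $g$ acts on the first level $X$. The Hanoi towers group is $\Gamma=\langle a,b,c\rangle$, where $a,b,c\in\mathrm{Aut}(X^* )$ are defined recursively by $a=(a,1,1)\sigma_{23}$, $b=(1,b,1)\sigma_{13}$, $c=(1,1,c)\sigma_{12}$, with $\sigma_{ij}$ the transposition of $i$ and $j$. For a vertex $u$ and $g\in\mathrm{Aut}(X^* )$, $u*g$ is the automorphism acting as $g$ on the subtree rooted at $u$ and trivially outside it: $(uw)^{u*g}=u\,w^g$ for all words $w$, and $v^{u*g}=v$ if $u$ is not a prefix of $v$. For $K\le\mathrm{Aut}(X^* )$, $u*K=\{u*k:k\in K\}$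 and $X^n*K=\prod_{|u|=n}u*K$ (internal direct product over the vertices of level $n$). A group $G\le\mathrm{Aut}(X^* )$ is self-similar if $G@u\subseteq G$ for every vertex $u$. It is level transitive if it acts transitively on the set of vertices of each level. It is regular branch with branching subgroup $K$ if $G$ is level transitive and $K$ is a subgroup of finite index in $G$ such that $u*K\le K$ for every vertex $u$ and $X^n*K$ has finite index in $G$ for all $n$. *)

(* Defs.v *)
From HB Require Import structures.
From mathcomp Require Import all_boot fingroup perm.
From mathcomp Require Import boolp classical_sets cardinality.

Set Implicit Arguments.
Unset Strict Implicit.
Unset Printing Implicit Defensive.

Local Open Scope group_scope.
Local Open Scope classical_set_scope.

Notation letter := 'I_3.

Definition letter1 : letter := @Ordinal 3 0 isT.
Definition letter2 : letter := @Ordinal 3 1 isT.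
Definition letter3 : letter := @Ordinal 3 2 isT.

Notation word := (seq letter).

Definition edge : rel word := fun u v =>
  [exists x, v == rcons u x] || [exists x, u == rcons v x].

Record is_tree_aut (f : word -> word) : Prop := IsTreeAut {
  tree_aut_bij : bijective f;
  tree_aut_nil : f [::] = [::];
  tree_aut_edge : {mono f : u v / edge u v} }.

Record tree_aut := TreeAut {
  tree_aut_fun :> word -> word;
  tree_autP : is_tree_aut tree_aut_fun }.

Lemma tree_aut_ext (g h : tree_aut) : g =1 h -> g = h.
Proof.
case: g h => [f Pf] [f' Pf'] /= /funext E; subst f'.
by congr TreeAut; exact: Prop_irrelevance.
Qed.

Lemma edgeP u v :
  reflect ((exists x, v = rcons u x) \/ (exists x, u = rcons v x)) (edge u v).
Proof.
apply: (iffP orP) => -[].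
- by move=> /existsP[x /eqP->]; left; exists x.
- by move=> /existsP[x /eqP->]; right; exists x.
- by move=> [x ->]; left; apply/existsP; exists x.
- by move=> [x ->]; right; apply/existsP; exists x.
Qed.

Lemma tree_aut_rcons f u x :
  is_tree_aut f -> exists y, f (rcons u x) = rcons (f u) y.
Proof.
move=> [/bij_inj fI f0 fE]; elim/last_ind: u x => [|u z IHu] x.
  have /edgeP : edge (f [::]) (f (rcons [::] x)).
    by rewrite fE; apply/edgeP; left; exists x.
  by rewrite f0 => -[//|[y /esym/(congr1 size)]]; rewrite size_rcons.
have /edgeP : edge (f (rcons u z)) (f (rcons (rcons u z) x)).
  by rewrite fE; apply/edgeP; left; exists x.
case=> // -[y]; have [t ->] := IHu z => /rcons_inj[/fI + _].
by move/(congr1 size)/eqP; rewrite !size_rcons ltn_eqF.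
Qed.

Lemma is_tree_aut_rcons f : bijective f -> f [::] = [::] ->
  (forall u x, exists y, f (rcons u x) = rcons (f u) y) -> is_tree_aut f.
Proof.
move=> fB f0 fS; split=> //.
have fI := bij_inj fB.
have fR u v x : f v = rcons (f u) x -> exists y, v = rcons u y.
  case/lastP: v => [|v z]; first by rewrite f0; case: (f u).
  by have [y ->] := fS v z => /rcons_inj[/fI-> _]; exists z.
move=> u v; apply/edgeP/edgeP => -[] [x].
- by move/fR; left.
- by move/fR; right.
- by move=> ->; left; exact: fS.
- by move=> ->; right; exact: fS.
Qed.

Lemma is_tree_aut_id : is_tree_aut id.
Proof. by split=> //; exists id. Qed.

Lemma is_tree_aut_comp f g :
  is_tree_aut f -> is_tree_aut g -> is_tree_aut (g \o f).
Proof.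
move=> [fB f0 fE] [gB g0 gE]; split=> [||u v]; first exact: bij_comp.
- by rewrite /= f0.
- by rewrite /= gE fE.
Qed.

Lemma tree_aut_invP (g : tree_aut) :
  {h : tree_aut | cancel g h /\ cancel h g}.
Proof.
apply: cid; case: (tree_autP g) => -[h gK hK] g0 gE.
have hP : is_tree_aut h.
  split=> [||u v]; first by exists g.
  - by rewrite -[in LHS]g0 gK.
  - by rewrite -gE !hK.
by exists (TreeAut hP).
Qed.

Definition tree_aut_one := TreeAut is_tree_aut_id.

(* Automorphisms act on the right: [g * h] applies [g] first. *)
Definition tree_aut_mul (g h : tree_aut) :=
  TreeAut (is_tree_aut_comp (tree_autP g) (tree_autP h)).

Definition tree_aut_inv (g : tree_aut) := sval (tree_aut_invP g).

HB.instance Definition _ := gen_eqMixin tree_aut.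
HB.instance Definition _ := gen_choiceMixin tree_aut.

Fact tree_aut_mulA : associative tree_aut_mul.
Proof. by move=> f g h; apply: tree_aut_ext. Qed.
Fact tree_aut_mul1g : left_id tree_aut_one tree_aut_mul.
Proof. by move=> g; apply: tree_aut_ext. Qed.
Fact tree_aut_mulg1 : right_id tree_aut_one tree_aut_mul.
Proof. by move=> g; apply: tree_aut_ext. Qed.
Fact tree_aut_mulVg : left_inverse tree_aut_one tree_aut_inv tree_aut_mul.
Proof.
by move=> g; apply: tree_aut_ext => u; case: (svalP (tree_aut_invP g)) => _;
exact.
Qed.
Fact tree_aut_mulgV : right_inverse tree_aut_one tree_aut_inv tree_aut_mul.
Proof.
by move=> g; apply: tree_aut_ext => u; case: (svalP (tree_aut_invP g)) => + _;
exact.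
Qed.

HB.instance Definition _ := isGroup.Build tree_aut tree_aut_mulA
  tree_aut_mul1g tree_aut_mulg1 tree_aut_mulVg tree_aut_mulgV.

Lemma tree_aut1E u : (1 : tree_aut) u = u. Proof. by []. Qed.

Lemma tree_autME (g h : tree_aut) u : (g * h) u = h (g u).
Proof. by []. Qed.

Lemma tree_autK (g : tree_aut) : cancel g g^-1.
Proof. by have [] := svalP (tree_aut_invP g). Qed.

Lemma tree_autKV (g : tree_aut) : cancel g^-1 g.
Proof. by have [] := svalP (tree_aut_invP g). Qed.

Section States.
Implicit Types (g : tree_aut) (u v w : word).

Lemma size_tree_aut g u : size (g u) = size u.
Proof.
elim/last_ind: u => [|u x IHu]; first by rewrite (tree_aut_nil (tree_autP g)).
by have [y ->] := tree_aut_rcons u x (tree_autP g); rewrite !size_rcons IHu.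
Qed.

Lemma tree_aut_cat g u w : g (u ++ w) = g u ++ drop (size u) (g (u ++ w)).
Proof.
rewrite -[LHS](cat_take_drop (size u)); congr (_ ++ _).
elim/last_ind: w => [|w x IHw].
  by rewrite cats0 -(size_tree_aut g) take_size.
rewrite -rcons_cat; have [y ->] := tree_aut_rcons (u ++ w) x (tree_autP g).
by rewrite -cats1 takel_cat // size_tree_aut size_cat leq_addr.
Qed.

Definition state_fun g u w := drop (size u) (g (u ++ w)).

Lemma is_tree_aut_state g u : is_tree_aut (state_fun g u).
Proof.
have E w : g (u ++ w) = g u ++ state_fun g u w by exact: tree_aut_cat.
apply: is_tree_aut_rcons.
- exists (state_fun g^-1 (g u)) => w; rewrite /state_fun.
    by rewrite -/(state_fun g u w) -E tree_autK size_tree_aut drop_size_cat.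
  have := tree_aut_cat g^-1 (g u) w; rewrite tree_autK => <-.
  by rewrite tree_autKV drop_size_cat // size_tree_aut.
- by rewrite /state_fun cats0 -(size_tree_aut g) drop_size.
- move=> w x; rewrite /state_fun -rcons_cat.
  have [y ->] := tree_aut_rcons (u ++ w) x (tree_autP g); exists y.
  by rewrite drop_rcons // size_tree_aut size_cat leq_addr.
Qed.

(* The state [g@u]. *)
Definition state g u := TreeAut (is_tree_aut_state g u).

Lemma stateE g u w : g (u ++ w) = g u ++ state g u w.
Proof. exact: tree_aut_cat. Qed.

Lemma state_unique g u (h : tree_aut) :
  (forall w, g (u ++ w) = g u ++ h w) -> h = state g u.
Proof.
move=> gE; apply: tree_aut_ext => w; have := gE w.
by rewrite stateE => /eqP; rewrite eqseq_cat // eqxx => /eqP.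
Qed.

Definition graft_fun u g v :=
  if prefix u v then u ++ g (drop (size u) v) else v.

Lemma graft_fun_cat u g w : graft_fun u g (u ++ w) = u ++ g w.
Proof. by rewrite /graft_fun prefix_prefix drop_size_cat. Qed.

Lemma graft_funK u g (h : tree_aut) :
  cancel g h -> cancel (graft_fun u g) (graft_fun u h).
Proof.
move=> gK v; have [/prefixP[w ->]|uv] := boolP (prefix u v).
  by rewrite !graft_fun_cat gK.
by rewrite /graft_fun (negPf uv) (negPf uv).
Qed.

Lemma is_tree_aut_graft u g : is_tree_aut (graft_fun u g).
Proof.
have g0 := tree_aut_nil (tree_autP g).
apply: is_tree_aut_rcons.
- exists (graft_fun u g^-1); apply: graft_funK; first exact: tree_autK.
  exact: tree_autKV.
- by rewrite /graft_fun; case: u => //=; rewrite g0.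
- move=> v x; have [/prefixP[w ->]|uv] := boolP (prefix u v).
    rewrite rcons_cat !graft_fun_cat.
    have [y ->] := tree_aut_rcons w x (tree_autP g).
    by exists y; rewrite rcons_cat.
  exists x; rewrite /graft_fun (negPf uv).
  case: ifP => // /prefixP[w]; case/lastP: w => [|w y].
    by rewrite cats0 => <-; rewrite drop_size g0 cats0.
  rewrite -rcons_cat => /rcons_inj[vE _].
  by move: uv; rewrite vE prefix_prefix.
Qed.

(* The automorphism [u * g]. *)
Definition graft u g := TreeAut (is_tree_aut_graft u g).

Lemma graft_cat u g w : graft u g (u ++ w) = u ++ g w.
Proof. exact: graft_fun_cat. Qed.

Lemma graft_id u g v : ~~ prefix u v -> graft u g v = v.
Proof. by rewrite /= /graft_fun => /negPf->. Qed.

Lemma graft_commute u v g h : size u = size v -> u != v ->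
  commute (graft u g) (graft v h).
Proof.
move=> suv uv; apply: tree_aut_ext => t; rewrite !tree_autME.
have sep u1 u2 w : size u1 = size u2 -> u1 != u2 -> ~~ prefix u1 (u2 ++ w).
  by move=> s12 u12; rewrite prefixE s12 take_size_cat // eq_sym.
have [/prefixP[w ->]|ut] := boolP (prefix u t).
  by rewrite graft_cat !(@graft_id v) ?graft_cat // sep // eq_sym.
rewrite (graft_id g ut); have [/prefixP[w tE]|vt] := boolP (prefix v t).
  by rewrite tE graft_cat graft_id // sep.
by rewrite (graft_id h vt) graft_id.
Qed.

End States.

(* The recursion g = (h_1, h_2, h_3) s with h_i = g and h_x = 1 for x != i. *)
Fixpoint hanoi_fun (i : letter) (s : {perm letter}) (w : word) : word :=
  if w is x :: v then s x :: (if x == i then hanoi_fun i s v else v)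
  else [::].

Lemma hanoi_funK i s :
  cancel (hanoi_fun i s) (hanoi_fun (s i) s^-1).
Proof.
elim=> //= x v IHv; rewrite permK (inj_eq perm_inj).
by have [xi|xi] := boolP (x == i); rewrite ?IHv.
Qed.

Lemma is_tree_aut_hanoi i s : is_tree_aut (hanoi_fun i s).
Proof.
apply: is_tree_aut_rcons => //.
- exists (hanoi_fun (s i) s^-1); first exact: hanoi_funK.
  by have := @hanoi_funK (s i) s^-1; rewrite permK invgK.
- elim=> [|z u IHu] x /=; first by exists (s x); rewrite if_same.
  case: ifP => _; last by exists x.
  by have [y ->] := IHu x; exists y.
Qed.

Definition hanoi i s := TreeAut (is_tree_aut_hanoi i s).

Lemma hanoi_state i s x :
  state (hanoi i s) [:: x] = if x == i then hanoi i s else 1.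
Proof.
apply/esym/state_unique => w /=; rewrite if_same /=.
by case: ifP => _.
Qed.

Definition hanoi_a : tree_aut := hanoi letter1 (tperm letter2 letter3).
Definition hanoi_b : tree_aut := hanoi letter2 (tperm letter1 letter3).
Definition hanoi_c : tree_aut := hanoi letter3 (tperm letter1 letter2).

Definition is_subgroup (gT : groupType) (H : set gT) : Prop :=
  group_closed (mem H).

Lemma is_subgroupP (gT : groupType) (H : set gT) :
  is_subgroup H <-> H 1 /\ (forall g h, H g -> H h -> H (g / h)).
Proof.
rewrite /is_subgroup /group_closed /divg_closed /prop_in2; split.
  move=> [H1 HM]; split=> [|g h Hg Hh]; first by move: H1; rewrite inE.
  have := HM g h; rewrite !inE; exact.
move=> [H1 HM]; split=> [|g h]; first by rewrite inE.
by rewrite !inE; exact: HM.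
Qed.

Definition gen_subgroup (gT : groupType) (S : set gT) : set gT :=
  smallest (@is_subgroup gT) S.

Definition commutator_subgroup (gT : groupType) (G : set gT) : set gT :=
  gen_subgroup [set [~ g, h] | g in G & h in G].

(* [H] is a subgroup of [G] with finitely many right cosets [H g], [g] in
   [G]. *)
Definition finite_index (gT : groupType) (H G : set gT) : Prop :=
  [/\ is_subgroup H, H `<=` G &
      finite_set [set [set h * g | h in H] | g in G]].

Definition self_similar (G : set tree_aut) : Prop :=
  is_subgroup G /\ forall u : word, [set state g u | g in G] `<=` G.

Definition level_transitive (G : set tree_aut) : Prop :=
  forall (n : nat) (u v : n.-tuple letter), exists2 g, G g & g u = v.

Definition graft_set (u : word) (K : set tree_aut) : set tree_aut :=
  [set graft u k | k in K].

(* The product [X^n * K] over the vertices of level [n]; the order of the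
   factors is irrelevant by [graft_commute]. *)
Definition level_prod (n : nat) (K : set tree_aut) : set tree_aut :=
  [set \prod_(u : n.-tuple letter) graft u (k u) |
    k in [set k : n.-tuple letter -> tree_aut | forall u, K (k u)]].

Definition regular_branch (G K : set tree_aut) : Prop :=
  [/\ is_subgroup G, level_transitive G, finite_index K G,
      forall u : word, graft_set u K `<=` K &
      forall n, finite_index (level_prod n K) G].

(* The Hanoi towers group. *)
Definition Gamma : set tree_aut := gen_subgroup [set hanoi_a; hanoi_b; hanoi_c].

(* Main.v *)
Require Import Defs.
From mathcomp Require Import all_boot fingroup perm.
From mathcomp Require Import boolp classical_sets cardinality.

(** Write [g_1], [g_2], [g_3] for the three generators: [g_i] fixes the letter
    [i], with state [g_i] there, and exchanges the two other letters, with
    trivial states. They are involutions, and every argument below is uniform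
    in [i].

    Transport. Some product of generators takes a letter [x] to itself with
    state [g_i] at [x]: it is [g_i] when [x = i], and otherwise the conjugate
    of [g_i] by the generator exchanging [x] and [i]. Multiplying such elements
    and then exchanging letters with trivial state, one gets, for all letters
    [x], [y] and all [h] in Gamma, an element of Gamma that takes [x] to [y]
    with state [h] at [x] ([Gamma_transport]). Level transitivity follows by
    induction on the level. Self-similarity holds because the states of the
    generators at letters are generators or trivial.

    Branching. For distinct [i], [j], [k], both [g_i] and [g_j ^ g_k] fix [i]
    and exchange [j] and [k]; their states at [i] are [g_i] and [g_j], while
    their other states are trivial and equal to [g_k] respectively, so these
    cancel in the commutator. Hence [[~ g_i, g_j ^ g_k]] is the commutator
    [[~ g_i, g_j]] grafted at the letter [i] ([commg_move_graft]). Conjugating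
    by the elements given by transport, every [[~ g_i, g_j] ^ h] grafted at
    every letter lies in the commutator subgroup. As these conjugates generate
    the commutator subgroup ([commutator_subgroup_sub_gen]) and grafting is a
    homomorphism, the commutator subgroup is stable under grafting at letters,
    hence at all words ([graft_commutator_sub]).

    Finite index. Modulo commutators, an element is one of the eight products
    [a ^+ e1 * b ^+ e2 * c ^+ e3] with boolean exponents, the generators being
    involutions. Now classify an element [g] of Gamma by its action on level
    [n] together with the class of each state [g@u], [u] of level [n]. There
    are finitely many classes, and if [g] and [h] are in the same one then
    [g / h] fixes level [n] and has all its states there in the commutator
    subgroup, which says exactly that it lies in the product over level [n]
    ([level_prodP]). *)

Set Implicit Arguments.
Unset Strict Implicit.
Unset Printing Implicit Defensive.

Local Open Scope group_scope.
Local Open Scope classical_set_scope.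

(** * Subgroups, commutator subgroups and finite index *)

Lemma subgroup1 (gT : groupType) (H : set gT) : is_subgroup H -> H 1.
Proof. by case/is_subgroupP. Qed.

Lemma subgroupV (gT : groupType) (H : set gT) g :
  is_subgroup H -> H g -> H g^-1.
Proof. by move=> /is_subgroupP[H1 HD] Hg; rewrite -div1g; apply: HD. Qed.

Lemma subgroupM (gT : groupType) (H : set gT) g h :
  is_subgroup H -> H g -> H h -> H (g * h).
Proof.
move=> HG Hg Hh; have /is_subgroupP[_ HD] := HG.
by rewrite -[h]invgK; apply: HD => //; apply: subgroupV.
Qed.

Lemma subgroupJ (gT : groupType) (H : set gT) g h :
  is_subgroup H -> H g -> H h -> H (g ^ h).
Proof. by move=> HG Hg Hh; do !apply: subgroupM => //; apply: subgroupV. Qed.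

Lemma subgroupR (gT : groupType) (H : set gT) g h :
  is_subgroup H -> H g -> H h -> H [~ g, h].
Proof.
move=> HG Hg Hh; rewrite commgEl.
by apply: subgroupM => //; [apply: subgroupV | apply: subgroupJ].
Qed.

Lemma is_subgroupMV (gT : groupType) (H : set gT) : H 1 ->
  (forall g h, H g -> H h -> H (g * h)) -> (forall g, H g -> H g^-1) ->
  is_subgroup H.
Proof.
by move=> H1 HM HV; apply/is_subgroupP; split=> // g h Hg Hh; apply/HM/HV.
Qed.

Lemma gen_subgroup_is_subgroup (gT : groupType) (S : set gT) :
  is_subgroup (gen_subgroup S).
Proof.
apply/is_subgroupP; split=> [H [HG _]|g h Gg Gh H HS]; first exact: subgroup1.
by have /is_subgroupP[_ HD] := HS.1; apply: HD; [exact: Gg | exact: Gh].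
Qed.

Lemma sub_gen_subgroup (gT : groupType) (S : set gT) : S `<=` gen_subgroup S.
Proof. exact: sub_smallest. Qed.

Lemma gen_subgroup_sub (gT : groupType) (S H : set gT) :
  is_subgroup H -> S `<=` H -> gen_subgroup S `<=` H.
Proof. by move=> HG SH; apply: smallest_sub. Qed.

(** When the generating set is closed under inverses, the monoid generated is
    already the group, so left multiplication by generators suffices. *)
Lemma gen_subgroup_ind (gT : groupType) (S P : set gT) :
  (forall s, S s -> S s^-1) -> P 1 -> (forall s g, S s -> P g -> P (s * g)) ->
  gen_subgroup S `<=` P.
Proof.
move=> SV P1 PM.
(* The equivalence, and not only the implication, makes [H] closed under
   inverses. *)
pose H := [set g | forall h, P h <-> P (g * h)].
suff HS : gen_subgroup S `<=` H.
  by move=> g /HS /(_ 1)[+ _]; rewrite mulg1; apply.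
apply: gen_subgroup_sub => [|s Ss h].
  apply/is_subgroupP; split=> [h|g k Hg Hk h]; first by rewrite mul1g.
  rewrite -mulgA; apply: iff_trans (Hg _).
  by apply: iff_sym; rewrite -{2}[h](mulVKg k); apply: Hk.
split=> [|Psh]; first exact: PM.
by rewrite -[h](mulKg s); apply: PM => //; apply: SV.
Qed.

Lemma commutator_subgroup_is_subgroup (gT : groupType) (G : set gT) :
  is_subgroup (commutator_subgroup G).
Proof. exact: gen_subgroup_is_subgroup. Qed.

Lemma mem_commutator (gT : groupType) (G : set gT) g h :
  G g -> G h -> commutator_subgroup G [~ g, h].
Proof. by move=> Gg Gh; apply: sub_gen_subgroup; exists g => //; exists h. Qed.

Lemma commutator_subgroup_sub (gT : groupType) (G : set gT) :
  is_subgroup G -> commutator_subgroup G `<=` G.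
Proof.
move=> GG; apply: gen_subgroup_sub => // _ [g Gg [h Gh <-]].
exact: subgroupR.
Qed.

Lemma commutator_subgroupJ (gT : groupType) (G : set gT) g h :
  is_subgroup G -> commutator_subgroup G g -> G h ->
  commutator_subgroup G (g ^ h).
Proof.
move=> GG + Gh; move: g; pose H := [set g | commutator_subgroup G (g ^ h)].
have G'G := commutator_subgroup_is_subgroup G.
apply: (@gen_subgroup_sub _ _ H) => [|_ [x Gx [y Gy <-]]]; last first.
  by rewrite /H /= conjRg; apply: mem_commutator; apply: subgroupJ.
apply: is_subgroupMV => [|x y|x]; rewrite /H /= ?conj1g ?conjMg ?conjVg.
- exact: subgroup1.
- exact: subgroupM.
- exact: subgroupV.
Qed.

(** The commutator subgroup is the normal closure of the commutators of the
    generators. [P] itself need not be normal, hence the conjugates in the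
    hypothesis. *)
Lemma commutator_subgroup_sub_gen (gT : groupType) (S P : set gT) :
  is_subgroup P ->
  (forall x y h, S x -> S y -> gen_subgroup S h -> P ([~ x, y] ^ h)) ->
  commutator_subgroup (gen_subgroup S) `<=` P.
Proof.
set G := gen_subgroup S => PG PS; have GG := gen_subgroup_is_subgroup S.
(* [N] is the largest part of [P] that conjugation by [G] preserves. *)
pose N := [set n | forall h, G h -> P (n ^ h)].
have NG : is_subgroup N.
  apply: is_subgroupMV => [h _|x y Nx Ny h Gh|x Nx h Gh].
  - by rewrite conj1g; apply: subgroup1.
  - by rewrite conjMg; apply: subgroupM; auto.
  - by rewrite conjVg; apply: subgroupV; auto.
have NJ n h : N n -> G h -> N (n ^ h).
  by move=> Nn Gh k Gk; rewrite -conjgM; apply: (Nn (h * k)); apply: (subgroupM GG).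
(* This is the centralizer of [y] modulo [N]; once it contains the generators it
   is all of [G]. This is used twice, for each argument of the commutator. *)
have centN (y : gT) : is_subgroup [set x | G x /\ N [~ x, y]].
  apply: is_subgroupMV => [|x z [Gx Nx] [Gz Nz]|x [Gx Nx]] /=.
  - by rewrite comm1g; split; [apply: (subgroup1 GG) | apply: (subgroup1 NG)].
  - split; first exact: (subgroupM GG).
    suff -> : [~ x * z, y] = [~ x, y] ^ z * [~ z, y].
      by apply: (subgroupM NG) => //; apply: NJ.
    by rewrite !commgEl !conjgE !gnorm.
  - split; first exact: (subgroupV GG).
    suff -> : [~ x^-1, y] = ([~ x, y] ^ x^-1)^-1.
      by apply: (subgroupV NG); apply: NJ => //; apply: (subgroupV GG).
    by rewrite !commgEl !conjgE !gnorm.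
have NV x y : N [~ x, y] -> N [~ y, x].
  by rewrite -[[~ y, x]]invgR; apply: (subgroupV NG).
suff GN x y : G x -> G y -> N [~ x, y].
  apply: gen_subgroup_sub => // _ [x Gx [y Gy <-]].
  by rewrite -[[~ x, y]]conjg1; apply: GN => //; apply: (subgroup1 GG).
suff SN s z : S s -> G z -> N [~ s, z].
  move=> Gx Gy; case: (gen_subgroup_sub (centN y) _ Gx) => // s Ss.
  by split; [apply: sub_gen_subgroup | apply: SN].
move=> Ss Gz; apply: NV; case: (gen_subgroup_sub (centN s) _ Gz) => // t St.
by split=> [|h Gh]; [apply: sub_gen_subgroup | apply: PS].
Qed.

(** Elements with the same class [t] lie in the same coset, so there are at
    most as many cosets as classes. The classifier [R] is a relation to spare
    its users a choice of invariant. *)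
Lemma finite_index_classify (gT : groupType) (T : finType) (H G : set gT)
    (R : gT -> T -> Prop) :
  is_subgroup H -> H `<=` G -> (forall g, G g -> exists t, R g t) ->
  (forall g h t, G g -> G h -> R g t -> R h t -> H (g / h)) ->
  finite_index H G.
Proof.
move=> HG sHG Rex RH; split=> //.
(* A representative in [G] of each class that meets [G]. *)
have /choice[c cP] (t : T) : exists g, (exists2 h, G h & R h t) -> G g /\ R g t.
  have [[h Gh Rht]|no] := pselect (exists2 h, G h & R h t); first by exists h.
  by exists 1 => /no.
apply: (@sub_finite_set _ _ [set [set h * c t | h in H] | t in [set: T]]).
  move=> _ [g Gg <-]; have [t Rgt] := Rex g Gg.
  have [Gc Rct] : G (c t) /\ R (c t) t by apply: cP; exists g.
  exists t => //; apply/seteqP; split=> _ [h Hh <-].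
    exists (h * (c t / g)); last by rewrite -mulgA mulgVK.
    by apply: subgroupM => //; apply: (RH _ _ t).
  exists (h * (g / c t)); last by rewrite -mulgA mulgVK.
  by apply: subgroupM => //; apply: (RH _ _ t).
exact/finite_image/finite_finset.
Qed.

(** * States *)

Lemma stateM g h u : state (g * h) u = state g u * state h (g u).
Proof.
apply/esym/state_unique => w.
by rewrite !tree_autME stateE stateE.
Qed.

Lemma state1 u : state 1 u = 1.
Proof. exact/esym/state_unique. Qed.

Lemma stateV g u : state g^-1 (g u) = (state g u)^-1.
Proof. by apply: (mulgI (state g u)); rewrite -stateM !mulgV state1. Qed.

Lemma state_nil g : state g [::] = g.
Proof.
by apply/esym/state_unique => w; rewrite (tree_aut_nil (tree_autP g)).
Qed.

Lemma state_cat g u v : state g (u ++ v) = state (state g u) v.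
Proof.
apply/esym/state_unique => w; rewrite -catA stateE (stateE (state g u)).
by rewrite catA -stateE.
Qed.

Lemma graft_nil g : graft [::] g = g.
Proof. by apply: tree_aut_ext => w; rewrite -[w in LHS]cat0s graft_cat. Qed.

Lemma graft1 u : graft u 1 = 1.
Proof.
apply: tree_aut_ext => v; have [/prefixP[w ->]|uv] := boolP (prefix u v).
  by rewrite graft_cat.
by rewrite graft_id.
Qed.

Lemma graftM u g h : graft u (g * h) = graft u g * graft u h.
Proof.
apply: tree_aut_ext => v; have [/prefixP[w ->]|uv] := boolP (prefix u v).
  by rewrite tree_autME !graft_cat.
by rewrite tree_autME !graft_id.
Qed.

Lemma graftV u g : graft u g^-1 = (graft u g)^-1.
Proof. by apply: (mulgI (graft u g)); rewrite -graftM !mulgV graft1. Qed.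

Lemma graft_graft u v g : graft u (graft v g) = graft (u ++ v) g.
Proof.
apply: tree_aut_ext => t; have [/prefixP[w ->]|ut] := boolP (prefix u t).
  rewrite graft_cat; have [/prefixP[x ->]|vw] := boolP (prefix v w).
    by rewrite graft_cat [in RHS]catA graft_cat catA.
  rewrite !graft_id //; apply: contra vw => /prefixP[x].
  rewrite -catA => /eqP; rewrite eqseq_cat // eqxx => /eqP->.
  exact: prefix_prefix.
rewrite !graft_id //; apply: contra ut => /prefixP[x ->].
by rewrite -catA prefix_prefix.
Qed.

(** Conjugation moves the support of a grafted automorphism: this is how a
    commutator found at one letter reaches the others. *)
Lemma graftJ u g h : graft u g ^ h = graft (h u) (g ^ state h u).
Proof.
rewrite conjgE; apply: (mulgI h); rewrite mulVKg.
apply: tree_aut_ext => t; rewrite !tree_autME.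
have [/prefixP[w ->]|ut] := boolP (prefix u t).
  by rewrite graft_cat !(stateE h) graft_cat !tree_autME tree_autK.
rewrite !graft_id //; apply: contra ut => /prefixP[w htE].
have := congr1 h^-1 htE; rewrite tree_autK => ->.
by rewrite stateE tree_autK prefix_prefix.
Qed.

Lemma tree_aut_prefix (g h : tree_aut) u w :
  g (u ++ w) = h (u ++ w) -> g u = h u.
Proof.
rewrite !stateE => /eqP.
by rewrite eqseq_cat ?size_tree_aut // => /andP[/eqP].
Qed.

(** Words shorter than [n] are no obstacle: an automorphism maps prefixes to
    prefixes, so its action on longer words determines its action on them. *)
Lemma tree_aut_eq_level n (g h : tree_aut) :
  (forall (u : n.-tuple letter) w, g (u ++ w) = h (u ++ w)) -> g = h.
Proof.
move=> gh; apply: tree_aut_ext => v.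
apply: (@tree_aut_prefix g h v (nseq n letter1)).
have sz : size (take n (v ++ nseq n letter1)) == n.
  by rewrite size_takel // size_cat size_nseq leq_addl.
by rewrite -(cat_take_drop n (v ++ nseq n letter1)); exact: (gh (Tuple sz)).
Qed.

(** * Products over a level *)

Lemma prod_graft_cat n (k : n.-tuple letter -> tree_aut)
    (u : n.-tuple letter) w :
  (\prod_(v : n.-tuple letter) graft v (k v)) (u ++ w) = u ++ k u w.
Proof.
suff H (r : seq (n.-tuple letter)) : uniq r ->
    (\prod_(v <- r) graft v (k v)) (u ++ w) = u ++ (if u \in r then k u w else w).
  by rewrite H ?mem_index_enum ?index_enum_uniq.
elim: r w => [|v r IHr] w /=; first by rewrite big_nil.
case/andP=> vr ur; rewrite big_cons tree_autME inE.
have [uv|uv] := eqVneq u v.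
  by rewrite -uv graft_cat IHr // uv (negPf vr).
by rewrite graft_id ?IHr // prefixE !size_tuple take_size_cat ?size_tuple.
Qed.

(** The factors of a product over a level are its states there. This makes
    the product a subgroup without reordering commuting factors. *)
Lemma level_prodP n (K : set tree_aut) g :
  level_prod n K g <->
  (forall u : n.-tuple letter, g u = u /\ K (state g u)).
Proof.
split=> [[k Kk <-] u|gK].
  set p : tree_aut := \prod_(v : n.-tuple letter) graft v (k v).
  have pE w : p (u ++ w) = u ++ k u w.
    exact: prod_graft_cat.
  have pu : p u = u.
    by have := pE [::]; rewrite (tree_aut_nil (tree_autP _)) cats0.
  suff <- : k u = state p u by [].
  by apply: state_unique => w; rewrite pE pu.
exists (fun u => state g u) => [u|]; first by case: (gK u).
apply: (@tree_aut_eq_level n) => u w.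
by rewrite prod_graft_cat stateE; case: (gK u) => ->.
Qed.

Lemma level_prod_is_subgroup n (K : set tree_aut) :
  is_subgroup K -> is_subgroup (level_prod n K).
Proof.
move=> KG; apply: is_subgroupMV => [|g h /level_prodP gK /level_prodP hK|
                                     g /level_prodP gK]; apply/level_prodP => u.
- by rewrite state1; split=> //; apply: subgroup1.
- have [[gu Kg] [hu Kh]] := (gK u, hK u).
  by rewrite stateM tree_autME gu; split=> //; apply: subgroupM.
- have [gu Kg] := gK u; have gVu : g^-1 u = u by rewrite -[in LHS]gu tree_autK.
  by rewrite -[X in state _ X]gu stateV; split=> //; apply: subgroupV.
Qed.

Lemma level_prod_sub n (H K : set tree_aut) : is_subgroup H ->
  (forall u, graft_set u K `<=` H) -> level_prod n K `<=` H.
Proof.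
move=> HG KH _ [k Kk <-]; apply: (big_ind H) => [|g h|u _].
- exact: subgroup1.
- exact: subgroupM.
- by apply: (KH u); exists (k u).
Qed.

(** * The Hanoi generators *)

(** Indexing the generators by the letter that they fix lets one computation on
    three distinct letters replace the six computations on actual letters. *)
Definition move (i : letter) : tree_aut :=
  nth 1 [:: hanoi_a; hanoi_b; hanoi_c] i.

Lemma letterP (x : letter) : [\/ x = letter1, x = letter2 | x = letter3].
Proof.
by case: x => [[|[|[|//]]] x3];
   [constructor 1 | constructor 2 | constructor 3]; apply: val_inj.
Qed.

Lemma moveE (i j k : letter) :
  uniq [:: i; j; k] -> move i = hanoi i (tperm j k).
Proof.
by case: (letterP i) => ->; case: (letterP j) => ->;
   case: (letterP k) => -> //= _;
   rewrite tpermC.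
Qed.

Lemma letter_cases (i j k x : letter) :
  uniq [:: i; j; k] -> [\/ x = i, x = j | x = k].
Proof.
by case: (letterP i) => ->; case: (letterP j) => ->;
   case: (letterP k) => -> //= _;
   case: (letterP x) => ->;
   [> first [by constructor 1 | by constructor 2 | by constructor 3] ..].
Qed.

Lemma third_letter (i j : letter) : i != j -> exists k, uniq [:: i; j; k].
Proof.
by case: (letterP i) => ->; case: (letterP j) => -> //= _;
   first [by exists letter1 | by exists letter2 | by exists letter3].
Qed.

Lemma other_letters (i : letter) : exists j k, uniq [:: i; j; k].
Proof.
case: (letterP i) => ->; first by exists letter2, letter3.
  by exists letter1, letter3.
by exists letter1, letter2.
Qed.

Lemma move_fix i w : move i (i :: w) = i :: move i w.
Proof.
have [j [k ijk]] := other_letters i; rewrite (moveE ijk) /= eqxx tpermD //.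
  by apply: contraTneq ijk => ->; rewrite /= mem_head.
by apply: contraTneq ijk => ->; rewrite /= !inE eqxx orbT.
Qed.

Lemma move_swap i j k w : uniq [:: i; j; k] -> move i (j :: w) = k :: w.
Proof.
move=> ijk; rewrite (moveE ijk) /= tpermL ifN //.
by apply: contraTneq ijk => ->; rewrite /= mem_head.
Qed.

Lemma state_move_fix i : state (move i) [:: i] = move i.
Proof.
by apply/esym/state_unique => w; rewrite !move_fix (tree_aut_nil (tree_autP _)).
Qed.

Lemma state_move_swap i j : i != j -> state (move i) [:: j] = 1.
Proof.
case/third_letter=> k ijk; apply/esym/state_unique => w.
by rewrite !(move_swap _ ijk).
Qed.

Lemma uniq3_perms (i j k : letter) : uniq [:: i; j; k] ->
  [/\ uniq [:: i; k; j], uniq [:: j; i; k], uniq [:: j; k; i],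
      uniq [:: k; i; j] & uniq [:: k; j; i]].
Proof.
by case: (letterP i) => ->; case: (letterP j) => ->;
   case: (letterP k) => -> //= _.
Qed.

Lemma move_mulK i : move i * move i = 1.
Proof.
apply: tree_aut_ext; elim=> [|x w IHw]; first exact: tree_aut_nil (tree_autP _).
rewrite tree_autME; have [j [k ijk]] := other_letters i.
have [ikj _ _ _ _] := uniq3_perms ijk.
case: (letter_cases x ijk) => ->; first by rewrite !move_fix -tree_autME IHw.
  by rewrite (move_swap _ ijk) (move_swap _ ikj).
by rewrite (move_swap _ ikj) (move_swap _ ijk).
Qed.

Lemma move_inv i : (move i)^-1 = move i.
Proof. by apply: (mulgI (move i)); rewrite mulgV move_mulK. Qed.

Lemma generatorP s : [set hanoi_a; hanoi_b; hanoi_c] s <-> exists i, s = move i.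
Proof.
split=> [[[]|] ->|[i ->]]; [by exists letter1 | by exists letter2 | by exists letter3 |].
by case: (letterP i) => ->; [left; left | left; right | right].
Qed.

Lemma Gamma_is_subgroup : is_subgroup Gamma.
Proof. exact: gen_subgroup_is_subgroup. Qed.

Lemma Gamma_move i : Gamma (move i).
Proof. by apply: sub_gen_subgroup; apply/generatorP; exists i. Qed.

Lemma Gamma_ind (P : set tree_aut) :
  P 1 -> (forall i g, P g -> P (move i * g)) -> Gamma `<=` P.
Proof.
move=> P1 PM; apply: gen_subgroup_ind => // [s|s g] /generatorP[i ->].
  by apply/generatorP; exists i; rewrite move_inv.
exact: PM.
Qed.

(** * Self-similarity and level transitivity *)

Lemma Gamma_state g u : Gamma g -> Gamma (state g u).
Proof.
elim: u g => [|x u IHu] g Gg; first by rewrite state_nil.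
rewrite -cat1s state_cat; apply: IHu.
suff: Gamma `<=` [set g | forall x, Gamma (state g [:: x])].
  by move/(_ g Gg); apply.
apply: Gamma_ind => [y|i h Gh y] /=.
  by rewrite state1; apply: (subgroup1 Gamma_is_subgroup).
rewrite stateM; apply: (subgroupM Gamma_is_subgroup); last first.
  by case: (move i [:: y]) (size_tree_aut (move i) [:: y]) => [|z []].
have [<-|iy] := eqVneq i y; first by rewrite state_move_fix; apply: Gamma_move.
by rewrite state_move_swap //; apply: (subgroup1 Gamma_is_subgroup).
Qed.

Lemma Gamma_self_similar : self_similar Gamma.
Proof.
split=> [|u _ [g Gg <-]]; first exact: Gamma_is_subgroup.
exact: Gamma_state.
Qed.

(** Gamma is self-replicating: the stabilizer of a letter maps onto Gamma by
    taking states there, and moreover letters can be exchanged without changing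
    the state. *)
Lemma Gamma_transport x y h : Gamma h ->
  exists2 t, Gamma t & t [:: x] = [:: y] /\ state t [:: x] = h.
Proof.
have GM := subgroupM Gamma_is_subgroup.
have stab i z : exists2 t, Gamma t &
    t [:: z] = [:: z] /\ state t [:: z] = move i.
  have [<-|iz] := eqVneq i z.
    exists (move i); first exact: Gamma_move.
    by rewrite move_fix state_move_fix (tree_aut_nil (tree_autP _)).
  have [k izk] := third_letter iz; have [_ _ _ kiz kzi] := uniq3_perms izk.
  have [ki kz] : k != i /\ k != z.
    by move: kiz => /=; rewrite !inE negb_or => /andP[/andP[]].
  (* The letter [z] travels along [z], [i], [i], [z], and only the middle step
     has a nontrivial state. *)
  exists (move k * (move i * move k)).
    by apply: (GM); [|apply: (GM)]; apply: Gamma_move.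
  rewrite !stateM !tree_autME (move_swap _ kzi) move_fix.
  rewrite (tree_aut_nil (tree_autP _)).
  by rewrite (move_swap _ kiz) state_move_fix !state_move_swap // mul1g mulg1.
have fixed : Gamma `<=` [set h | forall z, exists2 t, Gamma t &
    t [:: z] = [:: z] /\ state t [:: z] = h].
  apply: Gamma_ind => [z|i g IHg z].
    by exists 1; [apply: (subgroup1 Gamma_is_subgroup) | rewrite state1].
  have [s Gs [sz ss]] := stab i z; have [t Gt [tz ts]] := IHg z.
  exists (s * t); first exact: GM.
  by rewrite stateM tree_autME sz tz ss ts.
move=> /fixed /(_ x) [t Gt [tx ts]].
have [<-|xy] := eqVneq x y; first by exists t.
have [k xyk] := third_letter xy; have [_ _ _ kxy _] := uniq3_perms xyk.
exists (t * move k); first by apply: GM => //; apply: Gamma_move.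
rewrite stateM tree_autME tx ts (move_swap _ kxy) state_move_swap ?mulg1 //.
by move: kxy => /=; rewrite inE negb_or => /andP[/andP[]].
Qed.

Lemma Gamma_level_transitive : level_transitive Gamma.
Proof.
move=> n u v; have: size u = size v by rewrite !size_tuple.
elim: {u v}(u : word) (v : word) => [|x u IHu] [|y v] //= => [_|[/IHu[h Gh huv]]].
  by exists 1 => //; apply: (subgroup1 Gamma_is_subgroup).
have [t Gt [tx ts]] := Gamma_transport x y Gh.
by exists t => //; rewrite -cat1s stateE tx ts huv.
Qed.

(** * Branching over the commutator subgroup *)

(** The identity behind branching. Both elements fix [i] and exchange [j] and
    [k]; [move j ^ move k] has state [move k] at [j] and at [k], where [move i]
    has trivial states, so below [j] and [k] the commutator applies the
    involution [move k] twice, and is trivial. *)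
Lemma commg_move_graft i j k : uniq [:: i; j; k] ->
  [~ move i, move j ^ move k] = graft [:: i] [~ move i, move j].
Proof.
move=> ijk; have [ikj jik jki kij kji] := uniq3_perms ijk.
pose E := (move_fix, (move_swap _ ijk, move_swap _ ikj, move_swap _ jik),
  (move_swap _ jki, move_swap _ kij, move_swap _ kji)).
have K l w : move l (move l w) = w by rewrite -tree_autME move_mulK.
rewrite !commgEl !conjgE !invgM !move_inv; apply: tree_aut_ext => -[|x w].
  by rewrite !(tree_aut_nil (tree_autP _)).
have [xi|xi] := eqVneq x i.
  by rewrite xi -cat1s graft_cat !tree_autME !E.
rewrite graft_id; last by rewrite /= eq_sym (negPf xi).
by case: (letter_cases x ijk) xi => ->; rewrite ?eqxx // !tree_autME !E ?K.
Qed.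

Lemma graft_commg_move (x i j : letter) h : Gamma h ->
  commutator_subgroup Gamma (graft [:: x] ([~ move i, move j] ^ h)).
Proof.
have G'1 := subgroup1 (commutator_subgroup_is_subgroup Gamma).
move=> Gh; have [<-|ij] := eqVneq i j; first by rewrite commgg conj1g graft1.
have [k ijk] := third_letter ij; have [t Gt [tx ts]] := Gamma_transport i x Gh.
rewrite -tx -ts -graftJ -(commg_move_graft ijk).
apply: commutator_subgroupJ => //; first exact: Gamma_is_subgroup.
apply: mem_commutator; first exact: Gamma_move.
by apply: (subgroupJ Gamma_is_subgroup); apply: Gamma_move.
Qed.

Lemma graft_commutator_sub (u : word) :
  graft_set u (commutator_subgroup Gamma) `<=` commutator_subgroup Gamma.
Proof.
have G'G := commutator_subgroup_is_subgroup Gamma.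
suff G'x x : commutator_subgroup Gamma `<=`
    [set g | commutator_subgroup Gamma (graft [:: x] g)].
  move=> _ [g G'g <-]; elim: u => [|x u IHu]; first by rewrite graft_nil.
  by rewrite -cat1s -graft_graft; apply: G'x.
apply: commutator_subgroup_sub_gen => [|_ _ h /generatorP[i ->] /generatorP[j ->]].
  apply: is_subgroupMV => [|g h|g]; rewrite /= ?graft1 ?graftM ?graftV.
  - exact: (subgroup1 G'G).
  - exact: (subgroupM G'G).
  - exact: (subgroupV G'G).
exact: graft_commg_move.
Qed.

(** * Finite index *)

(** The cosets of the commutator subgroup: the abelianization is an elementary
    2-group generated by the three generators. *)
Definition parity_coset (e : bool * bool * bool) (g : tree_aut) : Prop :=
  exists2 k, commutator_subgroup Gamma k &
    g = k * (hanoi_a ^+ e.1.1 * (hanoi_b ^+ e.1.2 * hanoi_c ^+ e.2)).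

(** Modulo commutators [x] moves past [p] to meet its own power, and being an
    involution it toggles the exponent. *)
Lemma commutator_toggle (gT : groupType) (G : set gT) x k p q (e : bool) :
  is_subgroup G -> G x -> G p -> x * x = 1 -> commutator_subgroup G k ->
  exists2 k', commutator_subgroup G k' &
    x * (k * (p * (x ^+ e * q))) = k' * (p * (x ^+ (~~ e) * q)).
Proof.
move=> GG Gx Gp xx G'k; have G'G := commutator_subgroup_is_subgroup G.
exists (k ^ x^-1 * [~ x^-1, p^-1]).
  apply: (subgroupM G'G); first apply: commutator_subgroupJ => //.
    exact: subgroupV.
  by apply: mem_commutator; apply: subgroupV.
have -> : x ^+ (~~ e) = x * x ^+ e by case: e; rewrite //= ?mulg1 // expg1 xx.
rewrite conjgE invgK commgEl conjgE !invgK !mulgA.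
by rewrite !(mulgK, mulgVK).
Qed.

Lemma parity_coset_cover g : Gamma g -> exists e, parity_coset e g.
Proof.
have G'G := commutator_subgroup_is_subgroup Gamma; have GG := Gamma_is_subgroup.
have GX i (e : bool) : Gamma (move i ^+ e).
  by case: e; [apply: Gamma_move | apply: (subgroup1 GG)].
pose P := [set g | exists e, parity_coset e g].
move: g; apply: (Gamma_ind (P := P)) => [|i _ [[[e1 e2] e3] [k G'k ->]]].
  exists (false, false, false), 1; first exact: (subgroup1 G'G).
  by rewrite !mulg1.
have toggle := commutator_toggle _ _ GG (Gamma_move i) _ (move_mulK i) G'k.
case: (letterP i) => iE; rewrite iE in toggle *; rewrite /=.
- have [k' G'k' kE] := toggle 1 (hanoi_b ^+ e2 * hanoi_c ^+ e3) e1 (subgroup1 GG).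
  exists (~~ e1, e2, e3), k' => //.
  by move: kE; rewrite !mul1g.
- have [k' G'k' kE] := toggle (hanoi_a ^+ e1) (hanoi_c ^+ e3) e2 (GX letter1 e1).
  by exists (e1, ~~ e2, e3), k'.
- have [k' G'k' kE] := toggle (hanoi_a ^+ e1 * hanoi_b ^+ e2) 1 e3
    (subgroupM GG (GX letter1 e1) (GX letter2 e2)).
  exists (e1, e2, ~~ e3), k' => //.
  by move: kE; rewrite !mulg1 !mulgA.
Qed.

Lemma parity_coset_div e g h : parity_coset e g -> parity_coset e h ->
  commutator_subgroup Gamma (g / h).
Proof.
move=> [k G'k ->] [l G'l ->]; have G'G := commutator_subgroup_is_subgroup Gamma.
rewrite invgM mulgA mulgK; apply: (subgroupM G'G) => //.
exact: (subgroupV G'G).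
Qed.

Lemma commutator_finite_index : finite_index (commutator_subgroup Gamma) Gamma.
Proof.
apply: (@finite_index_classify _ _ _ _ (fun g e => parity_coset e g)).
- exact: commutator_subgroup_is_subgroup.
- exact: commutator_subgroup_sub Gamma_is_subgroup.
- exact: parity_coset_cover.
- by move=> g h e _ _; apply: parity_coset_div.
Qed.

Lemma level_prod_finite_index n :
  finite_index (level_prod n (commutator_subgroup Gamma)) Gamma.
Proof.
have G'G := commutator_subgroup_is_subgroup Gamma.
pose T := {ffun n.-tuple letter -> n.-tuple letter * (bool * bool * bool)}.
pose R (g : tree_aut) (t : T) := forall u : n.-tuple letter,
  g u = (t u).1 :> word /\ parity_coset (t u).2 (state g u).
apply: (@finite_index_classify _ _ _ _ R) => [|||g h t _ _ Rg Rh].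
- exact: level_prod_is_subgroup.
- apply: subset_trans (commutator_subgroup_sub Gamma_is_subgroup).
  exact: level_prod_sub graft_commutator_sub.
- move=> g Gg.
  have /choice[t tP] (u : n.-tuple letter) :
      exists p : n.-tuple letter * (bool * bool * bool),
        g u = p.1 :> word /\ parity_coset p.2 (state g u).
    have sz : size (g u) == n by rewrite size_tree_aut size_tuple.
    have [e gue] := parity_coset_cover (Gamma_state u Gg).
    by exists (Tuple sz, e).
  by exists [ffun u => t u] => u; rewrite ffunE.
- apply/level_prodP => u; have [[gu pg] [hu ph]] := (Rg u, Rh u).
  rewrite stateM tree_autME gu -hu tree_autK stateV; split=> //.
  exact: parity_coset_div pg ph.
Qed.

Theorem lemma3 : self_similar Gamma /\ regular_branch Gamma (commutator_subgroup Gamma).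
Proof.
split; first exact: Gamma_self_similar.
split; first exact: Gamma_is_subgroup.
- exact: Gamma_level_transitive.
- exact: commutator_finite_index.
- exact: graft_commutator_sub.
- exact: level_prod_finite_index.
Qed.
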